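(* Let $\varphi,\psi \colon G \to G$ be endomorphisms of an almost abelian group $G$ such that $R(\varphi,\psi) < \infty$. Then the natural map $\mathcal{R}(\varphi,\psi) \to \mathcal{R}(\widehat{\varphi},\widehat{\psi})$, $[x]_{\varphi,\psi} \mapsto [x\iota]_{\widehat{\varphi},\widehat{\psi}}$, is a bijection.
   Context: Maps are written on the right. A group is almost abelian if it has an abelian subgroup of finite index (no finite generation is assumed). For endomorphisms $\varphi,\psi$ of a group $G$, elements $x,y \in G$ are $(\varphi,\psi)$-twisted conjugate if there is $g \in G$ with $x = (g\varphi)^{-1} y (g\psi)$. This is an equivalence relation; $[x]_{\varphi,\psi}$ is the class of $x$, $\mathcal{R}(\varphi,\psi)$ is the set of classes, and $R(\varphi,\psi) = \lvert \mathcal{R}(\varphi,\psi) \rvert$. $\iota \colon G \to \widehat{G}$ denotes the profinite completion of $G$ (the canonical map $\iota$ need not be injective), and $\widehat{\varphi},\widehat{\psi} \colon \widehat{G} \to \widehat{G}$ are the continuous endomorphisms induced by $\varphi,\psi$; $\mathcal{R}(\widehat{\varphi},\widehat{\psi})$ is defined for the abstract group $\widehat{G}$ in the same way. *)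

(* Defs.v *)
From HB Require Import structures.
From mathcomp Require Import all_boot.
From mathcomp Require Import boolp classical_sets functions cardinality.
From mathcomp Require Import topology.

Set Implicit Arguments.
Unset Strict Implicit.
Unset Printing Implicit Defensive.

Local Open Scope classical_set_scope.
Local Open Scope quotient_scope.
Local Open Scope group_scope.

Notation ghom G H := (UMagmaMorphism.type G H).

Section Subgroups.
Variable G : groupType.
Implicit Types (H : set G) (x y : G).

Definition is_subgroup H : Prop :=
  H 1 /\ forall x y, H x -> H y -> H (x / y).

Definition is_normal H : Prop := forall x y, H x -> H (x ^ y).

Definition is_abelian H : Prop := forall x y, H x -> H y -> commute x y.

Definition lcoset x H : set G := [set x * h | h in H].

Definition finite_index H : Prop := finite_set (range (lcoset^~ H)).

Definition almost_abelian : Prop :=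
  exists H, [/\ is_subgroup H, is_abelian H & finite_index H].

Lemma is_subgroupV H x : is_subgroup H -> H x -> H x^-1.
Proof. by case=> H1 HF Hx; rewrite -[x^-1]mul1g; exact: HF. Qed.

Lemma is_subgroupM H x y : is_subgroup H -> H x -> H y -> H (x * y).
Proof.
move=> sH Hx Hy; rewrite -[y]invgK; apply: (proj2 sH) => //.
exact: is_subgroupV.
Qed.

Lemma lcosetE H x : lcoset x H = [set y | H (x^-1 * y)].
Proof.
apply/seteqP; split=> [_ [h Hh <-]|y /= Hy]; first by rewrite /= mulKg.
by exists (x^-1 * y) => //; rewrite mulVKg.
Qed.

End Subgroups.

Section TwistedConjugacy.
Variable G : groupType.
Variables phi psi : ghom G G.

Definition twisted_conj (x y : G) : Prop :=
  exists g, x = (phi g)^-1 * y * psi g.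

Definition twisted_conjb : rel G := fun x y => `[< twisted_conj x y >].

Fact twisted_conj_refl : reflexive twisted_conjb.
Proof. by move=> x; apply/asboolP; exists 1; rewrite !gmulf1 invg1 mul1g mulg1. Qed.

Fact twisted_conj_sub x y : twisted_conjb x y -> twisted_conjb y x.
Proof.
move=> /asboolP[g ->]; apply/asboolP; exists g^-1.
by rewrite !gmulfV invgK -!mulgA mulgV mulg1 mulgA mulgV mul1g.
Qed.

Fact twisted_conj_sym : symmetric twisted_conjb.
Proof. by move=> x y; apply/idP/idP; exact: twisted_conj_sub. Qed.

Fact twisted_conj_trans : transitive twisted_conjb.
Proof.
move=> y x z /asboolP[g ->] /asboolP[h ->]; apply/asboolP; exists (h * g).
by rewrite !gmulfM invgM !mulgA.
Qed.

Canonical twisted_conj_equiv :=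
  EquivRel twisted_conjb twisted_conj_refl twisted_conj_sym twisted_conj_trans.

Definition reidemeister : Type := {eq_quot twisted_conj_equiv}.

HB.instance Definition _ := Choice.on reidemeister.
HB.instance Definition _ := EqQuotient.on reidemeister.

Definition twisted_class (x : G) : reidemeister := \pi_reidemeister x.

Lemma twisted_classP x y :
  twisted_class x = twisted_class y <-> twisted_conj x y.
Proof. by split=> [/eqmodP/asboolP|xy] //; apply/eqmodP/asboolP. Qed.

End TwistedConjugacy.

Section FiniteQuotients.
Variable G : groupType.

Record fin_normal := FinNormal {
  fn_set :> set G;
  fn_subgroup : is_subgroup fn_set;
  fn_normal : is_normal fn_set;
  fn_finite : finite_index fn_set }.

Variable N : fin_normal.

Definition coset_rel : rel G := fun x y => `[< fn_set N (x^-1 * y) >].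

Fact coset_rel_refl : reflexive coset_rel.
Proof. by move=> x; apply/asboolP; rewrite mulVg; case: (fn_subgroup N). Qed.

Fact coset_rel_sub x y : coset_rel x y -> coset_rel y x.
Proof.
move=> /asboolP /(is_subgroupV (fn_subgroup N)).
by rewrite invgM invgK => ?; apply/asboolP.
Qed.

Fact coset_rel_sym : symmetric coset_rel.
Proof. by move=> x y; apply/idP/idP; exact: coset_rel_sub. Qed.

Fact coset_rel_trans : transitive coset_rel.
Proof.
move=> y x z /asboolP xy /asboolP yz; apply/asboolP.
by have := is_subgroupM (fn_subgroup N) xy yz; rewrite -mulgA mulVKg.
Qed.

Canonical coset_equiv :=
  EquivRel coset_rel coset_rel_refl coset_rel_sym coset_rel_trans.

Definition quot : Type := {eq_quot coset_equiv}.

HB.instance Definition _ := Choice.on quot.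
HB.instance Definition _ := EqQuotient.on quot.

Lemma quot_piP x y : x = y %[mod quot] <-> fn_set N (x^-1 * y).
Proof. by split=> [/eqmodP/asboolP|xy] //; apply/eqmodP/asboolP. Qed.

Lemma quot_pi_ind (P : quot -> Prop) :
  (forall x, P (\pi_quot x)) -> forall a, P a.
Proof. by move=> Ppi a; rewrite -[a]reprK. Qed.

Lemma repr_quot x : fn_set N (x^-1 * repr (\pi_quot x)).
Proof. by apply/quot_piP; rewrite reprK. Qed.

Definition quot_one : quot := \pi_quot 1.
Definition quot_inv (a : quot) : quot := \pi_quot (repr a)^-1.
Definition quot_mul (a b : quot) : quot := \pi_quot (repr a * repr b).

Lemma pi_quotM x y : \pi_quot (x * y) = quot_mul (\pi x) (\pi y).
Proof.
apply/quot_piP; rewrite invgM.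
have Nx := repr_quot x; have Ny := repr_quot y.
set rx := repr _ in Nx *; set ry := repr _ in Ny *.
have -> : y^-1 * x^-1 * (rx * ry) = (x^-1 * rx) ^ y * (y^-1 * ry).
  by rewrite conjgE !mulgA mulgK.
apply: is_subgroupM (fn_subgroup N) _ Ny; exact: fn_normal.
Qed.

Lemma pi_quotV x : \pi_quot x^-1 = quot_inv (\pi x).
Proof.
apply/quot_piP; rewrite invgK; have Nx := repr_quot x.
have := fn_normal x^-1 (is_subgroupV (fn_subgroup N) Nx).
by rewrite conjgE invgM !invgK mulgK.
Qed.

Fact quot_mulA : associative quot_mul.
Proof.
move=> a b c; elim/quot_pi_ind: a => x; elim/quot_pi_ind: b => y.
elim/quot_pi_ind: c => z.
by rewrite -(pi_quotM y z) -(pi_quotM x y) -2!pi_quotM mulgA.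
Qed.

Fact quot_mul1 : left_id quot_one quot_mul.
Proof.
move=> a; elim/quot_pi_ind: a => x.
by rewrite -(pi_quotM 1 x) mul1g.
Qed.

Fact quot_mulr1 : right_id quot_one quot_mul.
Proof.
move=> a; elim/quot_pi_ind: a => x.
by rewrite -(pi_quotM x 1) mulg1.
Qed.

Fact quot_mulV : left_inverse quot_one quot_inv quot_mul.
Proof.
move=> a; elim/quot_pi_ind: a => x.
by rewrite -pi_quotV -(pi_quotM x^-1 x) mulVg.
Qed.

Fact quot_mulrV : right_inverse quot_one quot_inv quot_mul.
Proof.
move=> a; elim/quot_pi_ind: a => x.
by rewrite -pi_quotV -(pi_quotM x x^-1) mulgV.
Qed.

HB.instance Definition _ := isGroup.Build quot
  quot_mulA quot_mul1 quot_mulr1 quot_mulV quot_mulrV.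

Fact pi_quot_morph : monoid_morphism (\pi_quot : G -> quot).
Proof. by split=> // x y; rewrite pi_quotM. Qed.

HB.instance Definition _ :=
  isUMagmaMorphism.Build G quot (\pi_quot : G -> quot) pi_quot_morph.

End FiniteQuotients.

Definition quot_map (G : groupType) (M N : fin_normal G) (f : G -> G)
  (a : quot M) : quot N := \pi_(quot N) (f (repr a)).

Lemma quot_map_pi (G : groupType) (M N : fin_normal G) (f : ghom G G) :
  (M : set G) `<=` f @^-1` N ->
  forall x, quot_map N f (\pi_(quot M) x) = \pi_(quot N) (f x).
Proof.
move=> MN x; apply/esym/quot_piP; rewrite -gmulfV -gmulfM; apply: MN.
exact: repr_quot.
Qed.

Section Completion.
Variable G : groupType.

(* The inverse limit of the quotients G/N over the normal subgroups N of
   finite index, ordered by reverse inclusion. *)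
Definition compatible (x : forall N : fin_normal G, quot N) : Prop :=
  forall M N : fin_normal G, (M : set G) `<=` N -> quot_map N idfun (x M) = x N.

Record profinite := Profinite {
  pcoord :> forall N : fin_normal G, quot N;
  pcoordP : compatible pcoord }.

Lemma profiniteP (x y : profinite) : (forall N, x N = y N) -> x = y.
Proof.
case: x y => [x xP] [y yP] /= xy.
have {}xy : x = y by apply: functional_extensionality_dep.
by case: _ / xy in yP *; congr Profinite; exact: Prop_irrelevance.
Qed.

HB.instance Definition _ := gen_eqMixin profinite.
HB.instance Definition _ := gen_choiceMixin profinite.

Fact profinite_one_subproof : compatible (fun N => 1).
Proof. by move=> M N MN; rewrite (@quot_map_pi _ M N idfun). Qed.

Fact profinite_inv_subproof (x : profinite) : compatible (fun N => (x N)^-1).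
Proof.
move=> M N MN; rewrite -(pcoordP x MN).
elim/quot_pi_ind: (x M) => a; rewrite -gmulfV !(@quot_map_pi _ M N idfun) //.
by rewrite -gmulfV.
Qed.

Fact profinite_mul_subproof (x y : profinite) :
  compatible (fun N => x N * y N).
Proof.
move=> M N MN; rewrite -(pcoordP x MN) -(pcoordP y MN).
elim/quot_pi_ind: (x M) => a; elim/quot_pi_ind: (y M) => b.
by rewrite -gmulfM !(@quot_map_pi _ M N idfun) // -gmulfM.
Qed.

Definition profinite_one := Profinite profinite_one_subproof.
Definition profinite_inv x := Profinite (profinite_inv_subproof x).
Definition profinite_mul x y := Profinite (profinite_mul_subproof x y).

Fact profinite_mulA : associative profinite_mul.
Proof. by move=> x y z; apply: profiniteP => N; exact: mulgA. Qed.

Fact profinite_mul1 : left_id profinite_one profinite_mul.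
Proof. by move=> x; apply: profiniteP => N; exact: mul1g. Qed.

Fact profinite_mulr1 : right_id profinite_one profinite_mul.
Proof. by move=> x; apply: profiniteP => N; exact: mulg1. Qed.

Fact profinite_mulV : left_inverse profinite_one profinite_inv profinite_mul.
Proof. by move=> x; apply: profiniteP => N; exact: mulVg. Qed.

Fact profinite_mulrV : right_inverse profinite_one profinite_inv profinite_mul.
Proof. by move=> x; apply: profiniteP => N; exact: mulgV. Qed.

HB.instance Definition _ := isGroup.Build profinite
  profinite_mulA profinite_mul1 profinite_mulr1 profinite_mulV profinite_mulrV.

Definition profinite_coords (x : profinite) :
  prod_topology (fun N : fin_normal G => discrete_topology (quot N)) :=
  fun N => x N.

HB.instance Definition _ :=
  Topological.copy profinite (initial_topology profinite_coords).

Lemma cvg_profiniteP (F : set_system profinite) {FF : Filter F}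
    (x : profinite) :
  F --> x <-> forall N, F [set y | y N = x N].
Proof.
have -> : F --> x <-> profinite_coords @ F --> profinite_coords x.
  split=> [Fx|Fx A [_ [[W oW <-] Wx] /filterS]]; last first.
    by apply; apply: Fx; exact: open_nbhs_nbhs.
  exact: cvg_comp Fx (@initial_continuous _ _ profinite_coords x).
split=> [/cvg_sup + N|Fx].
  move/(_ N [set a | a N = x N]); apply; exists [set a | a N = x N] => //.
  split=> //; exists [set x N : discrete_topology (quot N)] => //.
  exact: discrete_open.
apply/cvg_sup => N A [_ [[W oW <-] Wx] WA]; move: (Fx N).
by apply: filterS => y /= yx; apply: WA; rewrite /= /profinite_coords yx.
Qed.

Lemma continuous_profiniteP (T : topologicalType) (h : T -> profinite) :
  continuous h <-> forall x N, \forall y \near x, h y N = h x N.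
Proof.
split=> [ch x N|hN x].
  exact: (iffLR (@cvg_profiniteP _ (fmap_filter h (nbhs_filter x)) _) (ch x)).
apply: (iffRL (@cvg_profiniteP _ (fmap_filter h (nbhs_filter x)) _)) => N.
exact: hN.
Qed.

Fact profinite_iota_subproof (g : G) : compatible (fun N => \pi_(quot N) g).
Proof. by move=> M N MN; rewrite (@quot_map_pi _ M N idfun). Qed.

Definition profinite_iota (g : G) : profinite := Profinite (profinite_iota_subproof g).

Fact profinite_iota_morph : monoid_morphism profinite_iota.
Proof. by split=> [|x y]; apply: profiniteP => N //; exact: gmulfM. Qed.

HB.instance Definition _ := isUMagmaMorphism.Build G profinite profinite_iota profinite_iota_morph.

Fact fn_setT_finite : finite_index [set: G].
Proof.
apply: (@sub_finite_set _ _ [set [set: G]]); last exact: finite_set1.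
by move=> _ [x _ <-]; rewrite /= lcosetE; apply/seteqP.
Qed.

Definition fn_setT : fin_normal G :=
  @FinNormal G [set: G] (conj I (fun _ _ _ _ => I)) (fun _ _ _ => I)
    fn_setT_finite.

Fact fn_setI_subgroup (M N : fin_normal G) : is_subgroup (M `&` N).
Proof.
have [M1 MF] := fn_subgroup M; have [N1 NF] := fn_subgroup N.
by split=> // x y [Mx Nx] [My Ny]; split; [exact: MF|exact: NF].
Qed.

Fact fn_setI_normal (M N : fin_normal G) : is_normal (M `&` N).
Proof. by move=> x y [Mx Nx]; split; exact: fn_normal. Qed.

Fact fn_setI_finite (M N : fin_normal G) : finite_index (M `&` N).
Proof.
apply: (@sub_finite_set _ _ ((fun p => p.1 `&` p.2) @`
  (range ((@lcoset G)^~ M) `*` range ((@lcoset G)^~ N)))); last first.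
  by apply: finite_image; apply: finite_setX; exact: fn_finite.
move=> _ [x _ <-]; exists (lcoset x M, lcoset x N); first by split; exists x.
by rewrite !lcosetE.
Qed.

Definition fn_setI (M N : fin_normal G) : fin_normal G :=
  FinNormal (fn_setI_subgroup M N) (fn_setI_normal (M:=M) (N:=N))
    (fn_setI_finite M N).

Lemma pcoord_sub (M N : fin_normal G) (x y : profinite) :
  (M : set G) `<=` N -> x M = y M -> x N = y N.
Proof. by move=> MN xy; rewrite -(pcoordP x MN) xy (pcoordP y MN). Qed.

Lemma profinite_iota_dense : dense (range profinite_iota).
Proof.
move=> U [x Ux] oU; pose F := filter_from [set: fin_normal G]
  (fun N => [set y : profinite | y N = x N]).
have FF : Filter F.
  apply: filter_from_filter; first by exists fn_setT.
  move=> M N _ _; exists (fn_setI M N) => // y /= yx.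
  by split; apply: pcoord_sub yx => z [].
have /(_ U) : F --> x by apply/cvg_profiniteP => N; exists N.
case; first exact: open_nbhs_nbhs.
move=> N _ NU; exists (profinite_iota (repr (x N))); split; last by exists (repr (x N)).
by apply: NU; rewrite /= reprK.
Qed.

End Completion.

Arguments profinite_iota {G} g.

Section Preimage.
Variables (G : groupType) (f : ghom G G) (N : fin_normal G).

Fact preim_subgroup : is_subgroup (f @^-1` N).
Proof.
have [N1 NF] := fn_subgroup N.
by split=> [|x y]; rewrite /preimage/= ?gmulf1 ?gmulfF //; exact: NF.
Qed.

Fact preim_normal : is_normal (f @^-1` N).
Proof. by move=> x y; rewrite /preimage/= gmulfJ; exact: fn_normal. Qed.

Fact preim_finite : finite_index (f @^-1` N).
Proof.
apply: (@sub_finite_set _ _ (preimage f @` range ((@lcoset G)^~ N))); last first.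
  by apply: finite_image; exact: fn_finite.
move=> _ [x _ <-]; exists (lcoset (f x) N); first by exists (f x).
by rewrite !lcosetE /preimage/=; apply/seteqP; split=> y /=; rewrite gmulfM gmulfV.
Qed.

Definition preim_fin_normal : fin_normal G :=
  FinNormal preim_subgroup preim_normal preim_finite.

End Preimage.

Section Induced.
Variables (G : groupType) (f : ghom G G).

Fact induced_subproof (x : profinite G) :
  compatible (fun N => quot_map N f (x (preim_fin_normal f N))).
Proof.
move=> M N MN.
have fMN : (preim_fin_normal f M : set G) `<=` preim_fin_normal f N.
  by move=> y; exact: MN.
rewrite -(pcoordP x fMN); elim/quot_pi_ind: (x _) => a.
by rewrite (quot_map_pi (f := idfun)) // !quot_map_pi // (quot_map_pi (f := idfun)).
Qed.

(* The N-component is the image of the f^-1(N)-component of x under the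
   homomorphism G/f^-1(N) -> G/N given by f; by induced_continuous,
   induced_iota and induced_unique, this is the unique continuous extension
   of f to the completion. *)
Definition induced (x : profinite G) : profinite G :=
  Profinite (induced_subproof x).

Fact induced_morph : monoid_morphism induced.
Proof.
split=> [|x y]; apply: profiniteP => N /=.
  by rewrite quot_map_pi // gmulf1.
elim/quot_pi_ind: (pcoord x _) => a; elim/quot_pi_ind: (pcoord y _) => b.
by rewrite -gmulfM !quot_map_pi // !gmulfM.
Qed.

HB.instance Definition _ :=
  isUMagmaMorphism.Build (profinite G) (profinite G) induced induced_morph.

Lemma induced_iota g : induced (profinite_iota g) = profinite_iota (f g).
Proof. by apply: profiniteP => N /=; rewrite quot_map_pi. Qed.

Lemma induced_continuous : continuous induced.
Proof.
apply/continuous_profiniteP => x N.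
have /continuous_profiniteP/(_ x (preim_fin_normal f N)) :
  continuous (@idfun (profinite G)) by move=> y; exact: cvg_id.
by apply: filterS => y /= ->.
Qed.

Lemma induced_unique (h : profinite G -> profinite G) :
  continuous h -> (forall g, h (profinite_iota g) = profinite_iota (f g)) -> h = induced.
Proof.
move=> /continuous_profiniteP ch hf; apply/funext => x; apply: profiniteP => N.
have /continuous_profiniteP ci := induced_continuous.
have : nbhs x [set y | h y N = h x N /\ induced y N = induced x N].
  exact: filterI (ch x N) (ci x N).
rewrite nbhsE => -[U [oU Ux] UP].
have [y [/UP/=[<- <-] [g _ <-]]] := profinite_iota_dense (ex_intro _ x Ux) oU.
by rewrite hf -induced_iota.
Qed.

End Induced.

Section NaturalMap.
Variables (G : groupType) (phi psi : ghom G G).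

(* The value does not depend on the representative: see natural_mapE. *)
Definition natural_map (c : reidemeister phi psi) :
    reidemeister (induced phi) (induced psi) :=
  twisted_class (induced phi) (induced psi) (profinite_iota (repr c)).

Lemma natural_mapE x : natural_map (twisted_class phi psi x) =
  twisted_class (induced phi) (induced psi) (profinite_iota x).
Proof.
apply/twisted_classP.
have /twisted_classP[g ->] :
  twisted_class phi psi (repr (twisted_class phi psi x)) = twisted_class phi psi x.
  exact: reprK.
by exists (profinite_iota g); rewrite !gmulfM gmulfV /= !induced_iota.
Qed.

End NaturalMap.

Arguments natural_map {G} phi psi c.

(* Main.v *)
Require Import Defs.
From mathcomp Require Import all_boot.
From mathcomp Require Import boolp classical_sets functions cardinality.
From mathcomp Require Import filter topology.

(** Write [x] for the (phi, psi)-twisted class of x in G, and ^G for the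
    profinite completion.

    Surjectivity holds for every group with finitely many twisted classes. As an
    inverse limit of finite discrete groups, ^G is compact ([profinite_compact])
    and Hausdorff ([profinite_hausdorff]), and a twisted class of ^G is the image
    of ^G under the continuous map g |-> (g phi^)^-1 y (g psi^), hence closed
    ([twisted_class_closed]). The classes of the points x iota are finite in
    number, so their union is closed; it contains the dense image of G, so it is
    all of ^G ([natural_map_surj]).

    Injectivity is the statement that the twisted classes of G can be separated
    in finite quotients, and this is where an abelian subgroup A of finite index
    is used. It suffices that every class [x] contains a coset xN with N normal of
    finite index ([twisted_class_open]): if x iota and y iota are conjugate in ^G,
    then reducing the conjugating element modulo the preimages of N gives some
    (h phi)^-1 y (h psi) in xN, so y lies in [x] ([twisted_conj_iota]).

    To find N, consider the elements b such that both (b phi)^x and b psi lie in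
    A. Since A is abelian, the elements D(b) = ((b phi)^x)^-1 (b psi) form a
    subgroup of A, and x D(b) = (b phi)^-1 x (b psi) lies in [x]. This subgroup
    has finite index: for a in A write x a = (g phi)^-1 s (g psi), where s runs
    over the finitely many chosen representatives of the classes. If a and a' have
    the same s, and their elements g and g' satisfy (g phi)^x A = (g' phi)^x A and
    (g psi) A = (g' psi) A, then b = g^-1 g' gives a' = ((b phi)^x)^-1 a (b psi),
    which is a D(b) because A is abelian. Now take for N the normal core of this
    subgroup.

    Finiteness of an index is handled through finite colorings of the group in
    which elements of the same color lie in the same coset; they combine by
    pairing, so that no counting of cosets occurs. *)

Set Implicit Arguments.
Unset Strict Implicit.
Unset Printing Implicit Defensive.

Local Open Scope classical_set_scope.
Local Open Scope quotient_scope.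
Local Open Scope group_scope.

Lemma finite_range_coloring (X : Type) (T : choiceType) (f : X -> T) :
  finite_set (range f) ->
  exists n (c : X -> 'I_n), forall x y, c x = c y -> f x = f y.
Proof.
move=> /finite_seqP[s fs].
have f_s x : f x \in s by have : range f (f x) by [exists x]; rewrite fs.
have lt_s x : index (f x) s < size s by rewrite index_mem.
exists (size s), (fun x => Ordinal (lt_s x)) => x y [eq_xy].
by rewrite -(nth_index (f x) (f_s x)) eq_xy nth_index.
Qed.

Lemma coloring_section (G : groupType) (T : Type) (c : G -> T) :
  exists r : T -> G, forall x, c (r (c x)) = c x.
Proof.
exists (fun t => xget 1 [set x | c x = t]) => x.
by apply: (@xgetPex _ _ [set y | c y = c x]); exists x.
Qed.

Section FiniteIndex.
Variable G : groupType.
Implicit Types H A : set G.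

(** This lemma and its converse below turn the choice of finitely many coset
    invariants of an element into a proof that an index is finite. *)
Lemma finite_index_coloring H : is_subgroup H -> finite_index H ->
  exists n (c : G -> 'I_n), forall x y, c x = c y -> H (x^-1 * y).
Proof.
move=> sH /finite_range_coloring[n [c cP]]; exists n, c => x y /cP xy.
have : lcoset y H y by exists 1; rewrite ?mulg1 //; case: sH.
by rewrite -xy lcosetE.
Qed.

Lemma coloring_finite_index H (T : finType) (c : G -> T) :
  is_subgroup H -> (forall x y, c x = c y -> H (x^-1 * y)) -> finite_index H.
Proof.
move=> sH cP; have [r rK] := coloring_section c.
apply: (@sub_finite_set _ _ ((fun t => lcoset (r t) H) @` [set: T])); last first.
  by apply: finite_image; exact: finite_finset.
move=> _ [x _ <-]; exists (c x) => //.
have Hrx := cP _ _ (rK x).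
rewrite !lcosetE; apply/seteqP; split=> y /= Hy.
  by have := is_subgroupM sH (is_subgroupV sH Hrx) Hy; rewrite invgM invgK -mulgA mulVKg.
by have := is_subgroupM sH Hrx Hy; rewrite -mulgA mulVKg.
Qed.

(** The core of H is the intersection of its conjugates. A conjugate of H by g
    depends only on the coset of g, so x modulo the core is determined by the
    permutation that x induces on the cosets of H; the coloring used is this
    permutation, read on representatives. *)
Lemma normal_core H : is_subgroup H -> finite_index H ->
  exists N : fin_normal G, (N : set G) `<=` H.
Proof.
move=> sH /(finite_index_coloring sH)[n [c cP]].
pose K := [set x | forall g, H (x ^ g)].
have sK : is_subgroup K.
  split=> [g|x y Kx Ky g]; first by rewrite conj1g; case: sH.
  by rewrite conjMg conjVg; apply: (proj2 sH).
have nK : is_normal K by move=> x y Kx g; rewrite -conjgM.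
have [r rK] := coloring_section c.
have fK : finite_index K.
  apply: (@coloring_finite_index _ _ (fun x => [ffun i => c (x * r i)])) => //.
  move=> x y /ffunP xy g; have {xy} := xy (c g); rewrite !ffunE => /cP.
  have Hrg := cP _ _ (rK g).
  set s := r _ in Hrg * => Hxy.
  have -> : (x^-1 * y) ^ g = (s^-1 * g)^-1 * ((x * s)^-1 * (y * s)) * (s^-1 * g).
    by rewrite conjgE !invgM !invgK !mulgA !mulgK.
  by do 2?[apply: is_subgroupM => //]; exact: is_subgroupV.
by exists (FinNormal sK nK fK) => x /(_ 1); rewrite conjg1.
Qed.

End FiniteIndex.

(** Twisted classes are open for the profinite topology of G. Conjugating phi by x
    moves the question to the class of 1, where b |-> ((b phi)^x)^-1 (b psi) has
    its values in the abelian subgroup A, once b is restricted suitably, and is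
    then a homomorphism. *)
Lemma twisted_class_open (G : groupType) (phi psi : ghom G G) (x : G) :
  almost_abelian G -> finite_set [set: reidemeister phi psi] ->
  exists N : fin_normal G, forall n, fn_set N n -> twisted_conj phi psi (x * n) x.
Proof.
move=> [A [sA abA /(finite_index_coloring sA)[n [c cP]]]] finR.
have [m [d dP]] : exists m (d : G -> 'I_m), forall y z,
    d y = d z -> twisted_class phi psi y = twisted_class phi psi z.
  by apply: finite_range_coloring; exact: sub_finite_set finR.
pose B := [set b | A (phi b ^ x) /\ A (psi b)].
pose f b := (phi b ^ x)^-1 * psi b.
have sD : is_subgroup (f @` B).
  split.
    exists 1; last by rewrite /f !gmulf1 conj1g invg1 mulg1.
    by rewrite /B /= !gmulf1 conj1g; case: sA.
  move=> _ _ [b [Ab1 Ab2] <-] [e [Ae1 Ae2] <-]; exists (b / e).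
    by split; rewrite gmulfF ?conjMg ?conjVg; apply: (proj2 sA).
  rewrite /f !gmulfF conjMg conjVg.
  move: (phi b ^ x) (psi b) (phi e ^ x) (psi e) Ab1 Ab2 Ae1 Ae2.
  move=> p q r s Ap Aq Ar As; rewrite !invgM !invgK.
  have Apqs : A (p^-1 * q * s^-1).
    by do ![apply: is_subgroupM => //|apply: is_subgroupV => //].
  by rewrite !mulgA -(abA _ _ Ar Apqs) !mulgA.
have fD : finite_index (f @` B).
  have [r rK] := coloring_section c.
  (* a y is the part of y in A, after removing a representative of the coset
     y A; the color of y records this coset, the twisted class of x (a y), and the
     cosets of the images of the element g y that conjugates x (a y) to the
     representative of its class. *)
  pose a y := (r (c y))^-1 * y.
  have Aa y : A (a y) by exact: cP (rK y).
  have /choice[g gP] : forall y, exists g,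
      x * a y = (phi g)^-1 * repr (twisted_class phi psi (x * a y)) * psi g.
    by move=> y; apply/twisted_classP; rewrite [RHS]reprK.
  apply: (@coloring_finite_index _ _ _
    (fun y => (c y, d (x * a y), c (phi (g y) ^ x), c (psi (g y))))) => //.
  move=> y z [cyz /dP dyz c1 c2].
  have -> : y^-1 * z = (a y)^-1 * a z.
    by rewrite /a cyz !invgM !invgK -!mulgA mulVKg.
  pose b := (g y)^-1 * g z.
  have Bb : B b.
    by rewrite /B /b /= !gmulfM !gmulfV conjMg conjVg; split; exact: cP.
  exists b => //; rewrite /f.
  have az : a z = (phi b ^ x)^-1 * a y * psi b.
    have := gP z; rewrite -dyz; have := gP y; move: (repr _) => s xay xaz.
    have s_y : s = phi (g y) * (x * a y) / psi (g y).
      by rewrite xay !mulgA mulgV mul1g mulgK.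
    apply: (mulgI x); rewrite xaz s_y /b conjgE.
    by rewrite !gmulfM !gmulfV !invgM !invgK !mulgA mulgV mul1g.
  case: Bb => Ab _.
  by rewrite az (abA _ _ (is_subgroupV sA Ab) (Aa y)) -(mulgA (a y)) mulKg.
have [N ND] := normal_core sD fD; exists N => _ /ND[b _ <-].
by exists b; rewrite /f conjgE !invgM invgK !mulgA mulgV mul1g.
Qed.

Section ProfiniteSpace.
Variable G : groupType.

Lemma near_pcoord (x : profinite G) N :
  nbhs x [set y : profinite G | y N = x N].
Proof. by have /cvg_profiniteP : nbhs x --> x; [exact: cvg_id|exact]. Qed.

Lemma quot_finite (N : fin_normal G) : finite_set [set: quot N].
Proof.
have [n [c cP]] := finite_index_coloring (fn_subgroup N) (fn_finite N).
have [r rK] := coloring_section c.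
apply: (@sub_finite_set _ _
  ((fun i => \pi_(quot N) (r i)) @` [set: 'I_n])).
  elim/quot_pi_ind => x _; exists (c x) => //; apply/quot_piP.
  exact: cP (rK x).
by apply: finite_image; exact: finite_finset.
Qed.

Lemma profinite_hausdorff : hausdorff_space (profinite G).
Proof.
move=> p q pq; apply: profiniteP => N.
by have [z [/= <-]] := pq _ _ (near_pcoord p N) (near_pcoord q N).
Qed.

(** The pushforward of an ultrafilter to the finite set G/N concentrates on a
    single point; these points are the coordinates of its limit. *)
Lemma ultra_pcoord (F : set_system (profinite G)) N :
  UltraFilter F -> exists q : quot N, F [set y | y N = q].
Proof.
move=> UF; pose h (y : profinite G) : discrete_topology (quot N) := y N.
have [q [_ clq]] : [set: discrete_topology (quot N)] `&` cluster (h @ F) !=set0.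
  by apply: finite_compact filterT; exact: quot_finite.
exists q; pose S := [set y : profinite G | y N = q].
have [//|Fq] := in_ultra_setVsetC S UF.
have [_ [[y /= Sy <-] ?]] : (h @` ~` S) `&` [set q] !=set0.
  apply: clq; last exact: discrete_set1.
  by rewrite /fmap /=; apply: filterS Fq => y Sy; exists y.
by [].
Qed.

Lemma profinite_compact : compact [set: profinite G].
Proof.
rewrite compact_ultra => F UF _.
pose x N := xget 1 [set q : quot N | F [set y | y N = q]].
have Fx N : F [set y | y N = x N].
  exact: (@xgetPex _ _ [set q : quot N | F [set y | y N = q]])
    (ultra_pcoord N UF).
(* Two coordinates of the limit are realized by one and the same element y. *)
have xP : compatible x.
  move=> M N MN; have [y [/= <- <-]] := filter_ex (filterI (Fx M) (Fx N)).
  exact: pcoordP.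
by exists (Profinite xP); split=> //; apply/cvg_profiniteP.
Qed.

End ProfiniteSpace.

Section Reidemeister.
Variables (G : groupType) (phi psi : ghom G G).

Lemma twisted_class_closed (y : profinite G) :
  closed [set x | twisted_conj (induced phi) (induced psi) x y].
Proof.
pose f g := (induced phi g)^-1 * y * induced psi g.
have -> : [set x | twisted_conj (induced phi) (induced psi) x y] =
    f @` [set: profinite G].
  apply/seteqP; split=> [x [g ->]|_ [g _ <-]]; first by exists g.
  by exists g.
apply: compact_closed; first exact: profinite_hausdorff.
apply: continuous_compact; last exact: profinite_compact.
apply: continuous_subspaceT; apply/continuous_profiniteP => g N.
have /continuous_profiniteP/(_ g N) phi_g := @induced_continuous G phi.
have /continuous_profiniteP/(_ g N) psi_g := @induced_continuous G psi.
apply: filterS (filterI phi_g psi_g) => h [eq_phi eq_psi].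
by rewrite -[LHS]/((induced phi h N)^-1 * y N * induced psi h N) eq_phi eq_psi.
Qed.

Lemma natural_map_surj : finite_set [set: reidemeister phi psi] ->
  forall d, exists c, natural_map phi psi c = d.
Proof.
move=> finR d.
pose C (c : reidemeister phi psi) := [set x : profinite G |
  twisted_conj (induced phi) (induced psi) x (profinite_iota (repr c))].
have clC : closed (\bigcup_c C c).
  by apply: closed_bigcup => // c _; exact: twisted_class_closed.
have [c _ /twisted_classP eq_dc] : (\bigcup_c C c) (repr d).
  apply: contrapT => ndC.
  have [p [nCp [x _ px]]] := profinite_iota_dense
    (ex_intro (~` \bigcup_c C c) (repr d) ndC) (closed_openC clC).
  apply: nCp; exists (twisted_class phi psi x) => //; rewrite -px.
  by apply/twisted_classP; rewrite -natural_mapE.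
by exists c; rewrite /natural_map -eq_dc [LHS]reprK.
Qed.

(** A conjugating element g of the completion is only needed modulo the preimages
    of N under phi and psi, and there it is represented by an element h of G. *)
Lemma twisted_conj_iota x y : almost_abelian G ->
  finite_set [set: reidemeister phi psi] ->
  twisted_conj (induced phi) (induced psi) (profinite_iota x) (profinite_iota y) ->
  twisted_conj phi psi x y.
Proof.
move=> aaG finR [g xgy]; have [N xN] := twisted_class_open x aaG finR.
pose M := fn_setI (preim_fin_normal phi N) (preim_fin_normal psi N).
pose h := repr (g M).
have gM : profinite_iota h M = g M by exact: reprK.
have hphi : induced phi (profinite_iota h) N = induced phi g N.
  by rewrite /= -(pcoord_sub _ gM) // => z [].
have hpsi : induced psi (profinite_iota h) N = induced psi g N.
  by rewrite /= -(pcoord_sub _ gM) // => z [].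
pose w := (phi h)^-1 * y * psi h.
have Nxw : fn_set N (x^-1 * w).
  apply/quot_piP; rewrite -[LHS]/(profinite_iota x N) xgy.
  rewrite -[LHS]/((induced phi g N)^-1 * profinite_iota y N * induced psi g N).
  by rewrite -hphi -hpsi !induced_iota /w /= !gmulfM gmulfV.
apply/twisted_classP; have /twisted_classP <- := xN _ Nxw.
by rewrite mulVKg; apply/twisted_classP; exists h.
Qed.

End Reidemeister.

Theorem proposition2p8 (G : groupType) (phi psi : ghom G G) :
  almost_abelian G ->
  finite_set [set: reidemeister phi psi] ->
  bijective (natural_map phi psi).
Proof.
move=> aaG finR.
have /choice[f fK] := natural_map_surj finR.
have inj : injective (natural_map phi psi).
  move=> c d /twisted_classP/(twisted_conj_iota aaG finR)/twisted_classP.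
  by rewrite /twisted_class !reprK.
by exists f => // c; apply: inj; rewrite fK.
Qed.
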